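(* Let $R=\{(0,0),(0,1),(0,2),(1,0),(1,1),(1,2),(2,0),(2,1),(2,2)\}$. Then $(123,R)\sim_d(132,R)$.
   Context: $S_n$ denotes the set of permutations of $[n]=\{1,\dots,n\}$, written $\pi=\pi_1\cdots\pi_n$. A mesh pattern of length $k$ is a pair $(\tau,R)$ with $\tau\in S_k$ and $R\subseteq\{0,1,\dots,k\}^2$ (the shaded boxes; box $(a,b)$ is the unit square $[a,a+1]\times[b,b+1]$ in the diagram of $\tau$). An occurrence of $(\tau,R)$ in $\pi\in S_n$ is a choice of indices $i_1<\dots<i_k$ such that $\pi_{i_1}\cdots\pi_{i_k}$ is order-isomorphic to $\tau$ and, with $i_0=0$, $i_{k+1}=n+1$, $v_1<\dots<v_k$ the values $\pi_{i_1},\dots,\pi_{i_k}$ sorted increasingly, $v_0=0$, $v_{k+1}=n+1$, for every $(a,b)\in R$ there is no index $m$ with $i_a<m<i_{a+1}$ and $v_b<\pi_m<v_{b+1}$. Mesh patterns $p,q$ are equidistributed, $p\sim_d q$, if for all $n,\ell\ge0$ the number of $\pi\in S_n$ with exactly $\ell$ occurrences of $p$ equals the number with exactly $\ell$ occurrences of $q$. *)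

(* Defs.v *)
From mathcomp Require Import all_boot all_fingroup.

Set Implicit Arguments.
Unset Strict Implicit.
Unset Printing Implicit Defensive.

(* Permutations of [n] are elements of 'S_n, i.e. permutations of {0,...,n-1};
   position i and value pi i stand for i.+1 and (pi i).+1 in 1-based notation.
   Box coordinates range over {0,...,k} and are not shifted. *)

Record mesh_pattern (k : nat) := MeshPattern {
  mesh_perm : 'S_k;
  mesh_shading : {set 'I_k.+1 * 'I_k.+1}
}.

Section Occurrences.
Variables (k n : nat) (p : mesh_pattern k) (pi : 'S_n).

(* The 1-based positions i_0 = 0 < i_1 < ... < i_k < i_(k+1) = n+1. *)
Definition pos_bounds (i : {ffun 'I_k -> 'I_n}) : seq nat :=
  0 :: rcons [seq (i j).+1 | j <- enum 'I_k] n.+1.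

(* The 1-based values v_0 = 0 < v_1 < ... < v_k < v_(k+1) = n+1. *)
Definition val_bounds (i : {ffun 'I_k -> 'I_n}) : seq nat :=
  0 :: rcons (sort leq [seq (pi (i j)).+1 | j <- enum 'I_k]) n.+1.

Definition order_isomorphic (i : {ffun 'I_k -> 'I_n}) : bool :=
  [forall a : 'I_k, forall b : 'I_k, (pi (i a) < pi (i b)) ==
    (mesh_perm p a < mesh_perm p b)].

Definition in_box (i : {ffun 'I_k -> 'I_n}) (a b : nat) (m : 'I_n) : bool :=
  (nth 0 (pos_bounds i) a < m.+1 < nth 0 (pos_bounds i) a.+1) &&
  (nth 0 (val_bounds i) b < (pi m).+1 < nth 0 (val_bounds i) b.+1).

Definition occurrence (i : {ffun 'I_k -> 'I_n}) : bool :=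
  [&& [forall a : 'I_k, forall b : 'I_k, (a < b) ==> (i a < i b)],
      order_isomorphic i
    & [forall ab in mesh_shading p, forall m : 'I_n, ~~ in_box i ab.1 ab.2 m]].

Definition occurrences : nat := #|[set i | occurrence i]|.

End Occurrences.

Definition equidistributed (k1 k2 : nat)
    (p : mesh_pattern k1) (q : mesh_pattern k2) : Prop :=
  forall n l : nat,
    #|[set pi : 'S_n | occurrences p pi == l]| =
    #|[set pi : 'S_n | occurrences q pi == l]|.

Definition boxes (k : nat) (s : seq (nat * nat)) : {set 'I_k.+1 * 'I_k.+1} :=
  [set ab : 'I_k.+1 * 'I_k.+1 | (val ab.1, val ab.2) \in s].

Definition perm123 : 'S_3 := 1%g.

(* 132 fixes position 1 and swaps the values at positions 2 and 3. *)
Definition perm132 : 'S_3 := tperm (inord 1) (inord 2).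

(* Main.v *)
(** Read a permutation from left to right, recording at each step only the
    relative order of the entries seen so far: [pi : 'S_n.+1] is [lift_perm
    ord_max r s], where [r] is its last entry and [s] the pattern of the others.
    Since every box outside the last row and the last column is shaded, an
    occurrence is determined by its last position, and one ends at the last
    position of [pi] iff in [s] the values 0, 1 appear in this order and [r] is
    2 (for 123) or 1 (for 132).  When 0, 1 appear in this order in [s], they do
    so in [pi] for [r = 1] and for [r = 2] alike, so exchanging these two
    choices of [r] at every step is a bijection that turns occurrences of 123
    into occurrences of 132. *)

Require Import Defs.
From mathcomp Require Import all_boot all_fingroup.
From mathcomp Require Import zify.

Set Implicit Arguments.
Unset Strict Implicit.
Unset Printing Implicit Defensive.

(** * The two patterns and a direct description of their occurrences *)

Definition low_boxes : {set 'I_4 * 'I_4} :=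
  boxes 3 [:: (0, 0); (0, 1); (0, 2);
              (1, 0); (1, 1); (1, 2);
              (2, 0); (2, 1); (2, 2)].

(** One Boolean, telling whether the last two values descend, covers both patterns; as a number it
    enters the formulas [1 + t] and [2 - t]. *)
Definition pattern (t : bool) : mesh_pattern 3 :=
  MeshPattern (if t then perm132 else perm123) low_boxes.

(* All boxes up to the third row and column being shaded, the rectangle of
   positions up to [c] and values up to [maxn (pi b) (pi c)] contains no entries
   other than the occurrence. *)
Definition corner (t : bool) {n : nat} (pi : 'S_n) (a b c : 'I_n) : bool :=
  [&& a < b, b < c, pi a < pi b, pi a < pi c, (pi c < pi b) == t
    & [forall m : 'I_n, (m <= c) && ((pi m <= pi b) || (pi m <= pi c)) ==>
        (m \in [:: a; b; c])]].

Definition corner_end (t : bool) {n : nat} (pi : 'S_n) (c : 'I_n) : bool :=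
  [exists a, exists b, corner t pi a b c].

Definition low_ascent {n : nat} (pi : 'S_n) : bool :=
  [exists a : 'I_n, exists b : 'I_n,
    [&& a < b, pi a == 0 :> nat & pi b == 1 :> nat]].

(** * Three-element index sets and sorting *)

Local Notation o0 := (ord0 : 'I_3).
Local Notation o1 := (inord 1 : 'I_3).
Local Notation o2 := (inord 2 : 'I_3).

Lemma enum3 : enum 'I_3 = [:: o0; o1; o2].
Proof. by apply: (inj_map val_inj); rewrite val_enum_ord /= !inordK. Qed.

Lemma forall3 (P : 'I_3 -> bool) : [forall a, P a] = [&& P o0, P o1 & P o2].
Proof.
apply/forallP/and3P => [H | [H0 H1 H2] a]; first by split.
by have := mem_enum 'I_3 a; rewrite enum3 !inE => /or3P[] /eqP->.
Qed.

Lemma perm132E : (perm132 o0 = o0) * (perm132 o1 = o2) * (perm132 o2 = o1).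
Proof. by rewrite /perm132 tpermL tpermR tpermD // -val_eqE /= inordK. Qed.

Lemma sort_leqE (s s' : seq nat) :
  sorted leq s' -> perm_eq s s' -> sort leq s = s'.
Proof.
move=> ss' ps; apply: (sorted_eq leq_trans anti_leq) => //.
  exact: sort_sorted leq_total _.
by rewrite perm_sort.
Qed.

(** * Reduction of mesh occurrences to corners *)

Lemma in_low_boxes (ab : 'I_4 * 'I_4) :
  (ab \in low_boxes) = (ab.1 < 3) && (ab.2 < 3).
Proof.
case: ab => [[a ha] [b hb]]; rewrite inE /=.
by move: a b ha hb => [|[|[|[|a]]]] [|[|[|[|b]]]].
Qed.

Lemma mem_perm_vals n (pi : 'S_n) (m : 'I_n) (s : seq 'I_n) :
  (m \in s) = (nat_of_ord (pi m) \in [seq nat_of_ord (pi x) | x <- s]).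
Proof.
apply/esym/(@mem_map _ _ (fun x => nat_of_ord (pi x))).
by move=> x y /val_inj/perm_inj.
Qed.

Lemma between3 (x1 x2 x3 x4 x : nat) :
  0 < x1 -> x1 < x2 -> x2 < x3 ->
  [exists a : 'I_3, nth 0 [:: 0; x1; x2; x3; x4] a < x
                    < nth 0 [:: 0; x1; x2; x3; x4] a.+1] =
  [&& 0 < x, x < x3, x != x1 & x != x2].
Proof.
move=> h1 h2 h3; rewrite -[LHS]negbK negb_exists forall3 /= !inordK //=; lia.
Qed.

(** The nine boxes fill the lower left rectangle up to the grid lines through the occurrence, and by
    injectivity of [pi] an entry on such a line belongs to the occurrence. *)
Lemma low_boxes_empty n (pi : 'S_n) (i : {ffun 'I_3 -> 'I_n}) (u0 u1 u2 : nat) :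
  i o0 < i o1 -> i o1 < i o2 -> u0 < u1 -> u1 < u2 ->
  perm_eq [seq nat_of_ord (pi (i j)) | j <- enum 'I_3] [:: u0; u1; u2] ->
  [forall ab in low_boxes, forall m : 'I_n, ~~ in_box pi i ab.1 ab.2 m] =
  [forall m : 'I_n, (m <= i o2) && (pi m <= u2) ==>
    (m \in [:: i o0; i o1; i o2])].
Proof.
move=> i01 i12 u01 u12 pu.
have posE : pos_bounds i = [:: 0; (i o0).+1; (i o1).+1; (i o2).+1; n.+1].
  by rewrite /pos_bounds enum3.
have valE : val_bounds pi i = [:: 0; u0.+1; u1.+1; u2.+1; n.+1].
  rewrite /val_bounds (@sort_leqE _ [:: u0.+1; u1.+1; u2.+1]) //.
    by rewrite /= !ltnS; lia.
  by rewrite (map_comp succn (fun j => pi (i j) : nat)) (perm_map succn pu).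
have memE m : (m \in [:: i o0; i o1; i o2]) =
    (nat_of_ord (pi m) \in [:: u0; u1; u2]).
  by rewrite -(perm_mem pu) enum3 (mem_perm_vals pi).
apply/forallP/forallP => H.
  move=> m; apply/implyP => /andP[mi mu]; apply: contraT => mN.
  have [a ha] : exists a : 'I_3, nth 0 (pos_bounds i) a < m.+1
                    < nth 0 (pos_bounds i) a.+1.
    apply/existsP; rewrite posE between3 //.
    by move: mN; rewrite !inE -!val_eqE /=; lia.
  have [b hb] : exists b : 'I_3, nth 0 (val_bounds pi i) b < (pi m).+1
                    < nth 0 (val_bounds pi i) b.+1.
    apply/existsP; rewrite valE between3 //.
    by move: mN; rewrite memE !inE /=; lia.
  have := H (widen_ord (leqnSn 3) a, widen_ord (leqnSn 3) b).
  rewrite in_low_boxes /= !ltn_ord /= => /forallP/(_ m).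
  by rewrite /in_box ha hb.
move=> [a b]; rewrite in_low_boxes; apply/implyP => /andP[/= a3 b3].
apply/forallP => m; apply/negP => /andP[ha hb].
have: [exists a : 'I_3, nth 0 (pos_bounds i) a < m.+1
                    < nth 0 (pos_bounds i) a.+1].
  by apply/existsP; exists (Ordinal a3).
have: [exists b : 'I_3, nth 0 (val_bounds pi i) b < (pi m).+1
                    < nth 0 (val_bounds pi i) b.+1].
  by apply/existsP; exists (Ordinal b3).
rewrite posE valE !between3 // => hu hi.
have := H m; rewrite memE.
have := memE m; rewrite !inE -!val_eqE /=; lia.
Qed.

Lemma occurrenceE (t : bool) n (pi : 'S_n) (i : {ffun 'I_3 -> 'I_n}) :
  occurrence (pattern t) pi i = corner t pi (i o0) (i o1) (i o2).
Proof.
rewrite /occurrence /order_isomorphic /corner !forall3 !inordK //= !andbT.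
rewrite ltnn /=.
case: (ltnP (i o0) (i o1)) => //= i01; rewrite ?andbF //.
case: (ltnP (i o1) (i o2)) => //= i12; rewrite ?andbF //.
have i02 := ltn_trans i01 i12; rewrite i02 /=.
have inj x y : (pi x == pi y :> nat) = (x == y :> nat).
  by rewrite !val_eqE (inj_eq perm_inj).
have := inj (i o0) (i o1); have := inj (i o0) (i o2).
have := inj (i o1) (i o2) => e12 e02 e01.
set oi := (X in X && _); set sh := (X in _ && X).
have oiE : oi = [&& pi (i o0) < pi (i o1), pi (i o0) < pi (i o2)
                  & (pi (i o2) < pi (i o1)) == t].
  rewrite /oi {oi sh}; case: t => /=.
    by rewrite !perm132E !inordK //=; lia.
  by rewrite !perm1 !inordK //=; lia.
rewrite oiE -!andbA.
case: (ltnP (pi (i o0)) (pi (i o1))) => //= x01.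
case: (ltnP (pi (i o0)) (pi (i o2))) => //= x02.
case: eqP => //= x12; rewrite /sh.
(* Both patterns start with their smallest value, so sorting only concerns the last two. *)
rewrite (@low_boxes_empty _ _ _ (pi (i o0)) (minn (pi (i o1)) (pi (i o2)))
  (maxn (pi (i o1)) (pi (i o2)))) //; try lia.
  by apply: eq_forallb => m; rewrite leq_max.
rewrite enum3 /=; case: (leqP (pi (i o1)) (pi (i o2))) => // _.
by rewrite perm_cons (perm_catC [:: _] [:: _]).
Qed.

(** * Counting occurrences by their last position *)

(** If [pi b <= pi b'], then [a] and [b] lie in the region where the other corner allows only its
    own entries. *)
Lemma corner_uniq t n (pi : 'S_n) a b a' b' c :
  corner t pi a b c -> corner t pi a' b' c -> a = a' /\ b = b'.
Proof.
wlog le_bb : a b a' b' / pi b <= pi b' => [hw h h'|].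
  case/orP: (leq_total (pi b) (pi b')) => hb; first exact: hw.
  by case: (hw _ _ _ _ hb h' h).
case/and5P=> ab bc xab xac /andP[_ _] /and5P[ab' bc' _ _ /andP[_ /forallP H]].
have := H a; have := H b; rewrite !inE -!val_eqE /= => hb ha.
by split; apply: val_inj => /=; lia.
Qed.

Lemma occurrencesE t n (pi : 'S_n) :
  occurrences (pattern t) pi = \sum_(c < n) corner_end t pi c.
Proof.
rewrite -big_mkcond /= sum1_card /occurrences.
rewrite -(card_in_imset (f := fun i : {ffun 'I_3 -> 'I_n} => i o2)).
  apply: eq_card => c; rewrite unfold_in /=; apply/imsetP/existsP.
    case=> i; rewrite inE occurrenceE => h ->.
    by exists (i o0); apply/existsP; exists (i o1).
  case=> a /existsP[b h].
  (* The default [c] of [nth] supplies the third index. *)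
  exists [ffun j : 'I_3 => nth c [:: a; b] j]; last by rewrite ffunE inordK.
  by rewrite inE occurrenceE !ffunE !inordK.
move=> i i'; rewrite !inE !occurrenceE => h h' e.
move: h'; rewrite -e => /(corner_uniq h)[e0 e1].
apply/ffunP => j; have := mem_enum 'I_3 j.
by rewrite enum3 !inE => /or3P[] /eqP->.
Qed.

(** * Effect of appending a last entry *)

(** A corner ending at the last position contains every value up to its maximum, so its values are
    0, 1, 2, and [t] fixes their order. *)
Lemma corner_last t n (pi : 'S_n.+1) a b :
  corner t pi a b ord_max =
  [&& a < b, b < n, pi a == 0 :> nat, pi b == 1 + t :> nat
    & pi ord_max == 2 - t :> nat].
Proof.
apply/idP/idP.
  case/and5P=> ab bc xab xac /andP[xcb /forallP H]; rewrite ab bc /=.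
  have occ v : v <= maxn (pi b) (pi ord_max) ->
      v \in [:: pi a : nat; pi b : nat; pi ord_max : nat].
    move=> hv; have vn : v < n.+1.
      by apply: leq_ltn_trans hv _; rewrite gtn_max !ltn_ord.
    have := H (pi^-1 (Ordinal vn))%g; rewrite permKV -ltnS ltn_ord /=.
    by rewrite -leq_max hv /= (mem_perm_vals pi) permKV.
  have xbc : (pi b == pi ord_max :> nat) = false.
    by rewrite val_eqE (inj_eq perm_inj) -val_eqE ltn_eqF.
  have := occ 0; have := occ 1; have := occ 2; rewrite !inE.
  by move: xcb xbc; case: t => /eqP /=; lia.
case/and5P=> ab bc /eqP xa /eqP xb /eqP xc.
have xcb : (2 - t < 1 + t) == t by case: (t).
have t2 : 0 < 2 - t by case: (t).
rewrite /corner ab bc xa xb xc xcb t2 /=.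
apply/forallP => m; apply/implyP => /andP[_ hm].
rewrite (mem_perm_vals pi) !inE /= xa xb xc.
by case: (t) hm => /=; lia.
Qed.

(** Deleting the last value [2 - t] and closing the gap turns the value [1 + t] into 1 for either
    [t]. *)
Lemma corner_end_last t n (r : 'I_n.+1) (s : 'S_n) :
  corner_end t (lift_perm ord_max r s) ord_max =
  low_ascent s && (r == 2 - t :> nat).
Proof.
apply/existsP/andP.
  case=> a /existsP[b]; rewrite corner_last lift_perm_id.
  case: (unliftP ord_max a) => [a'|] ->; last by rewrite /= ltnNge -ltnS ltn_ord.
  case: (unliftP ord_max b) => [b'|] ->; last by rewrite /= ltnn andbF.
  rewrite !lift_perm_lift !lift_max ltn_ord /= /bump.
  case/and4P=> ab xa xb xr; split=> //.
  apply/existsP; exists a'; apply/existsP; exists b'.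
  by rewrite ab /=; move: xa xb xr; case: (t) => /=; lia.
case=> /existsP[a /existsP[b /and3P[ab /eqP xa /eqP xb]]] /eqP xr.
exists (lift ord_max a); apply/existsP; exists (lift ord_max b).
rewrite corner_last lift_perm_id !lift_perm_lift !lift_max ab ltn_ord /= /bump.
by rewrite xa xb xr; case: (t).
Qed.

(** A corner depends only on the relative order of the entries up to [c], which a new last entry
    does not change. *)
Lemma corner_end_lift t n (r : 'I_n.+1) (s : 'S_n) c :
  corner_end t (lift_perm ord_max r s) (lift ord_max c) = corner_end t s c.
Proof.
have cE a b : corner t (lift_perm ord_max r s)
    (lift ord_max a) (lift ord_max b) (lift ord_max c) = corner t s a b c.
  rewrite /corner !lift_perm_lift !lift_max.
  have lt_lift (x y : 'I_n) : (lift r x < lift r y) = (x < y).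
    by rewrite !ltnNge /= leq_bump2.
  rewrite !lt_lift; do 5 congr (_ && _).
  apply/forallP/forallP => H m.
    have := H (lift ord_max m).
    by rewrite !lift_perm_lift lift_max /= !leq_bump2 !inE !(inj_eq lift_inj).
  case: (unliftP ord_max m) => [m'|] ->.
    have := H m'.
    by rewrite !lift_perm_lift lift_max /= !leq_bump2 !inE !(inj_eq lift_inj).
  by rewrite /= leqNgt ltn_ord.
apply/existsP/existsP => [[a /existsP[b]]|[a /existsP[b h]]]; last first.
  by exists (lift ord_max a); apply/existsP; exists (lift ord_max b); rewrite cE.
case: (unliftP ord_max a) => [a'|] ->; last first.
  by rewrite /corner /= ltnNge -ltnS ltn_ord.
case: (unliftP ord_max b) => [b'|] ->; last first.
  by rewrite /corner !lift_max /= [n < c]ltnNge (ltnW (ltn_ord c)) /= andbF.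
by rewrite cE => h; exists a'; apply/existsP; exists b'.
Qed.

Lemma occurrences_lift t n (r : 'I_n.+1) (s : 'S_n) :
  occurrences (pattern t) (lift_perm ord_max r s) =
  occurrences (pattern t) s + (low_ascent s && (r == 2 - t :> nat)).
Proof.
rewrite !occurrencesE big_ord_recr /= corner_end_last; congr (_ + _).
apply: eq_bigr => c _; rewrite -(corner_end_lift t r); congr (corner_end _ _ _).
by apply: val_inj; rewrite /= /bump leqNgt ltn_ord.
Qed.

(** A last entry 0 cannot precede 1, a last entry 1 comes after 0, and a larger one leaves 0 and 1
    in place. *)
Lemma low_ascent_lift n (r : 'I_n.+1) (s : 'S_n) :
  low_ascent (lift_perm ord_max r s) =
  (r == 1 :> nat) || (1 < r) && low_ascent s.
Proof.
apply/existsP/orP.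
  case=> a /existsP[b].
  case: (unliftP ord_max a) => [a'|] ->; last by rewrite /= ltnNge -ltnS ltn_ord.
  case: (unliftP ord_max b) => [b'|] ->; last first.
    by rewrite lift_perm_id => /and3P[_ _ ->]; left.
  rewrite !lift_perm_lift !lift_max /= => /and3P[ab xa xb].
  case: (r == 1 :> nat) / eqP => r1; [by left | right].
  have r2 : 1 < r by move: xa; rewrite /bump; lia.
  rewrite r2; apply/existsP; exists a'; apply/existsP; exists b'.
  by move: xa xb; rewrite ab /bump; lia.
case=> [/eqP r1 | /andP[r2 /existsP[a /existsP[b /and3P[ab /eqP xa /eqP xb]]]]].
  have n0 : 0 < n by rewrite -ltnS -[X in X < _]r1.
  exists (lift ord_max (s^-1 (Ordinal n0))%g); apply/existsP; exists ord_max.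
  by rewrite lift_perm_lift lift_perm_id permKV lift_max /= /bump r1 ltn_ord.
exists (lift ord_max a); apply/existsP; exists (lift ord_max b).
by rewrite !lift_perm_lift !lift_max /= xa xb ab /bump; lia.
Qed.

(** Ensures that [inord 1] and [inord 2] in ['I_n.+1] really are 1 and 2. *)
Lemma low_ascent_size n (s : 'S_n) : low_ascent s -> 1 < n.
Proof.
by case/existsP=> a /existsP[b /and3P[_ _ /eqP <-]].
Qed.

(** * The bijection exchanging the two patterns *)

Lemma lift_perm_last_bij n :
  bijective (fun rs : 'I_n.+1 * 'S_n => lift_perm ord_max rs.1 rs.2).
Proof.
apply: inj_card_bij; last by rewrite card_prod card_ord !card_Sn factS.
move=> [r s] [r' s'] /= e.
have er : r = r' by rewrite -(lift_perm_id ord_max r s) e lift_perm_id.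
rewrite -er in e *; congr (_, _); apply/permP => x; apply: (@lift_inj _ r).
by rewrite -!(lift_perm_lift ord_max) e.
Qed.

(** Preservation of [low_ascent] is carried through the induction because it decides whether the
    next entry can complete an occurrence. *)
Lemma occurrence_exchange n : exists f : 'S_n -> 'S_n,
  [/\ bijective f, forall s, low_ascent (f s) = low_ascent s
    & forall s, occurrences (pattern true) (f s) =
                occurrences (pattern false) s].
Proof.
elim: n => [|n [f [[f' fK f'K] fa fo]]].
  by exists id; split=> // [|s]; [exists id | rewrite !occurrencesE !big_ord0].
have [d dK d'K] := lift_perm_last_bij n.
pose swap (s : 'S_n) (r : 'I_n.+1) :=
  if low_ascent s then tperm (inord 1) (inord 2) r else r.
have swapK s s' : low_ascent s = low_ascent s' -> cancel (swap s) (swap s').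
  by rewrite /swap => -> r; case: (low_ascent s'); rewrite ?tpermK.
(* The swap depends on [s] only through [low_ascent], which [f] preserves, so the swap attached to
   [f s] undoes it. *)
pose F (rs : 'I_n.+1 * 'S_n) := (swap rs.2 rs.1, f rs.2).
pose F' (rs : 'I_n.+1 * 'S_n) := (swap rs.2 rs.1, f' rs.2).
have FK : cancel F F' by case=> r s; rewrite /F /F' /= fK swapK.
have F'K : cancel F' F.
  by case=> r s; rewrite /F /F' /= f'K swapK // -(fa (f' s)) f'K.
have bD := lift_perm_last_bij n.
exists (fun s => lift_perm ord_max (F (d s)).1 (F (d s)).2).
have swapE s (r : 'I_n.+1) : low_ascent s ->
    (swap s r : nat) =
    if r == 1 :> nat then 2 else if r == 2 :> nat then 1 else r.
  move=> h; have n1 := low_ascent_size h; rewrite /swap h.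
  case: tpermP => [->|->|]; rewrite ?inordK //= ?ltnS ?(ltnW n1) //.
  move=> /eqP/negPf + /eqP/negPf; rewrite -!val_eqE /=.
  by rewrite !inordK ?ltnS ?(ltnW n1) // => -> ->.
split.
- exact: (bij_comp bD (bij_comp (Bijective FK F'K) (Bijective d'K dK))).
(* When [s] has a low ascent, last entries 1 and 2 both keep it, and the swap fixes all others. *)
- move=> s; rewrite -[in RHS](d'K s) /F !low_ascent_lift /= fa.
  case: (boolP (low_ascent (d s).2)) => h; last by rewrite /swap (negPf h).
  rewrite swapE // !andbT; case: ifP => [//|r1].
  by case: ifP => [/eqP-> //|_]; rewrite r1.
(* The swap sends the last entry 2, which completes a 123, to 1, which completes a 132. *)
move=> s; rewrite -[in RHS](d'K s) /F !occurrences_lift /= fa fo; congr (_ + _).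
case: (boolP (low_ascent _)) => //= h; rewrite swapE //.
by case: ifP => [/eqP-> //|r1]; case: ifP => [//|_]; rewrite r1.
Qed.

Theorem theorem3p3 :
  let R := boxes 3 [:: (0, 0); (0, 1); (0, 2);
                       (1, 0); (1, 1); (1, 2);
                       (2, 0); (2, 1); (2, 2)] in
  equidistributed (MeshPattern perm123 R) (MeshPattern perm132 R).
Proof.
move=> R n l; have [f [fb _ fo]] := occurrence_exchange n.
have foE s : occurrences (MeshPattern perm132 R) (f s) =
    occurrences (MeshPattern perm123 R) s by exact: fo.
(* The set on the left is the preimage under [f] of the one on the right. *)
rewrite -[RHS](on_card_preimset (onW_bij _ fb)); apply: eq_card => s.
by rewrite !inE foE.
Qed.
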